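(* Let $p$ be an odd prime and let $1\le n\le p-2$. Then $$\mathbf G_n(p)\equiv (p-1)\Bigl(\sum_{a=1}^{p-1}a^n\Bigr)(1+i^{\,n})\pmod{p^2}\qquad\text{in }\mathbb Z[i].$$
   Context: Here $i^2=-1$, and for an odd prime $p$ and integer $n\ge 0$, $\mathbf G_n(p)=\sum_{a=1}^{p-1}\sum_{b=1}^{p-1}(a+bi)^n\in\mathbb Z[i]$. *)

(* Defs.v *)
From HB Require Import structures.
From mathcomp Require Import all_boot all_order all_algebra all_field.

Set Implicit Arguments.
Unset Strict Implicit.
Unset Printing Implicit Defensive.

Import Order.TTheory GRing.Theory Num.Theory.

Local Open Scope ring_scope.

Definition gaussInteger_subdef : {pred algC} :=
  fun x => ('Re x \is a Num.int) && ('Im x \is a Num.int).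
Definition gaussInteger := [qualify a x | gaussInteger_subdef x].

Lemma gaussInteger_subring : subring_closed gaussInteger.
Proof.
split=> [|x y /andP[xr xi] /andP[yr yi]|x y /andP[xr xi] /andP[yr yi]];
  rewrite /gaussInteger qualifE; apply/andP.
- by rewrite (Creal_ReP _ _) ?(Creal_ImP _ _) ?rpred1 ?rpred0.
- by rewrite !raddfB /= !rpredB.
- by rewrite ReM ImM rpredB ?rpredD ?rpredM.
Qed.

HB.instance Definition _ :=
  GRing.isSubringClosed.Build algC gaussInteger_subdef gaussInteger_subring.

Lemma gaussInteger_i : 'i \is a gaussInteger.
Proof. by apply/andP; rewrite Re_i Im_i rpred0 rpred1. Qed.

(* Z[i] *)
Record gaussInt := GaussInt {
  gaussInt_val :> algC;
  gaussInt_valP : gaussInt_val \is a gaussInteger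
}.

HB.instance Definition _ := [isSub for gaussInt_val].
HB.instance Definition _ := [Choice of gaussInt by <:].
HB.instance Definition _ := [SubChoice_isSubComNzRing of gaussInt by <:].

Definition gaussI : gaussInt := GaussInt gaussInteger_i.

Definition congr_mod (R : comNzRingType) (m x y : R) : Prop :=
  exists z : R, x - y = m * z.

Definition gauss_power_sum (n p : nat) : gaussInt :=
  \sum_(1 <= a < p) \sum_(1 <= b < p) (a%:R + b%:R * gaussI) ^+ n.

(* Main.v *)
Require Import Defs.
From HB Require Import structures.
From mathcomp Require Import all_boot all_order all_algebra all_field.

Import Order.TTheory GRing.Theory Num.Theory.

Local Open Scope ring_scope.

(** Write S_k for the power sum 1^k + ... + (p-1)^k.  Expanding each
    (a + b i)^n by the binomial formula and summing over a and b separately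
    gives

      G_n(p) = sum over 0 <= k <= n of C(n,k) S_(n-k) S_k i^k.

    Since S_0 = p - 1, the two extreme terms k = 0 and k = n add up to the
    right-hand side of the congruence.  In every other term both exponents k
    and n - k lie strictly between 0 and p - 1, and p divides S_j for such j
    ([dvdn_power_sum]), so the term is a multiple of p^2.  Nothing here depends
    on i, and the argument is run for an arbitrary element t of a commutative
    ring ([congr_mod_sum_linear_forms]).

    The divisibility of S_j is the vanishing of the j-th power sum of a finite
    field ([finField_power_sum_eq0]). *)

(** The polynomial X^k - 1 has at most k roots, fewer than there are nonzero
    elements, so some nonzero g has g^k <> 1.  Multiplication by g permutes the field, hence multiplies the
    sum by g^k without changing it, which forces the sum to be 0. *)
Lemma finField_power_sum_eq0 (F : finFieldType) (k : nat) :
  (0 < k < #|F|.-1)%N -> \sum_(x : F) x ^+ k = 0.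
Proof.
case/andP=> k_gt0 k_lt.
have [g g_neq0 gk_neq1] : exists2 g : F, g != 0 & g ^+ k != 1.
  apply/exists_inP; apply: contraLR k_lt; rewrite negb_exists_in -leqNgt.
  move/forall_inP=> all_roots.
  have -> : #|F|.-1 = size (enum [pred x : F | x != 0]).
    by rewrite -cardE (cardC1 (0 : F)).
  apply: max_unity_roots (enum_uniq _) => //.
  apply/allP=> x; rewrite mem_enum => x_neq0.
  by rewrite unity_rootE; have := all_roots x x_neq0; rewrite negbK.
set s := \sum_x _.
have gs : s = g ^+ k * s.
  rewrite {1}/s (reindex_inj (mulfI g_neq0)) mulr_sumr.
  by apply: eq_bigr => x _; rewrite exprMn.
apply: contraNeq gk_neq1 => s_neq0.
by apply/eqP/(mulIf s_neq0); rewrite mul1r -gs.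
Qed.

Lemma dvdn_power_sum (p k : nat) :
  prime p -> (0 < k < p.-1)%N -> (p %| \sum_(1 <= a < p) a ^ k)%N.
Proof.
move=> p_prime k_bounds; have /andP[k_gt0 _] := k_bounds.
rewrite (dvdn_pcharf (pchar_Fp p_prime)) natr_sum; apply/eqP.
have sum_F : \sum_(x : 'F_p) x ^+ k = 0.
  by apply: finField_power_sum_eq0; rewrite card_Fp.
under eq_bigr do rewrite natrX.
rewrite -[RHS]sum_F.
rewrite [RHS](eq_bigr (fun x : 'F_p => (x : nat)%:R ^+ k)); last first.
  by move=> x _; rewrite natr_Zp.
rewrite -(big_mkord xpredT (fun a => (a%:R : 'F_p) ^+ k)) Fp_cast //.
(* The left-hand side starts at a = 1; the term a = 0 vanishes as k > 0. *)
by rewrite [RHS]big_ltn ?prime_gt0 // expr0n -[k == 0%N]negbK -lt0n k_gt0 add0r.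
Qed.

(** For fixed k the double sum of the binomial terms factors, since a and b
    range independently. *)
Lemma sum_linear_formsE (R : comNzRingType) (t : R) (n p : nat) :
  \sum_(1 <= a < p) \sum_(1 <= b < p) (a%:R + b%:R * t) ^+ n =
  \sum_(k < n.+1) (\sum_(1 <= a < p) a ^ (n - k))%:R
                * (\sum_(1 <= b < p) b ^ k)%:R * t ^+ k *+ 'C(n, k).
Proof.
under eq_bigr => a _.
  under eq_bigr do rewrite exprDn.
  rewrite exchange_big /=.
  over.
rewrite exchange_big; apply: eq_bigr => k _ /=.
rewrite !natr_sum !mulr_suml -sumrMnl; apply: eq_bigr => a _.
rewrite mulr_sumr mulr_suml -sumrMnl; apply: eq_bigr => b _.
by rewrite exprMn !natrX mulrA.
Qed.

Lemma congr_mod_sum_linear_forms (R : comNzRingType) (t : R) (n p : nat) :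
  prime p -> (0 < n < p.-1)%N ->
  congr_mod ((p ^ 2)%:R : R)
    (\sum_(1 <= a < p) \sum_(1 <= b < p) (a%:R + b%:R * t) ^+ n)
    ((p - 1)%:R * (\sum_(1 <= a < p) a ^ n)%:R * (1 + t ^+ n)).
Proof.
move=> p_prime /andP[n_gt0 n_lt]; rewrite sum_linear_formsE.
case: n n_gt0 n_lt => // m _ m_lt.
pose S k := (\sum_(1 <= a < p) a ^ k)%N.
have S0 : S 0%N = (p - 1)%N by rewrite /S sum_nat_const_nat muln1.
have S_div k : (0 < k <= m)%N -> (S k)%:R = p%:R * (S k %/ p)%:R :> R.
  case/andP=> k_gt0 k_le; rewrite -natrM mulnC divnK //.
  by apply: dvdn_power_sum; rewrite // k_gt0 (leq_trans _ m_lt) // ltnW.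
(* The term k = 0 of the expansion is split off below, so index k here stands
   for the exponent k + 1; each of its two power sums gives up one factor p. *)
exists (\sum_(k < m) (S (m - k)%N %/ p)%:R * (S k.+1 %/ p)%:R * t ^+ k.+1
                     *+ 'C(m.+1, k.+1)).
rewrite big_ord_recl big_ord_recr /= -/(S _) subn0 subnn -/(S 0%N) S0.
rewrite bin0 binn !mulr1n expr0 mulr1 /bump /= add1n.
rewrite mulrDr mulr1 -/(S m.+1) [(S m.+1)%:R * _]mulrC.
rewrite addrCA addrK mulr_sumr; apply: eq_bigr => k _.
rewrite add1n subSS -/(S _) -/(S _) !S_div; first last.
- by rewrite subn_gt0 ltn_ord leq_subr.
- by rewrite ltn_ord.
by rewrite [RHS]mulrnAr natrX expr2 (mulrACA p%:R) !mulrA.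
Qed.

Theorem theorem3 (p n : nat) (p_prime : prime p) (p_odd : odd p)
    (n_ge1 : (1 <= n)%N) (n_le : (n <= p - 2)%N) :
  congr_mod ((p ^ 2)%:R : gaussInt) (gauss_power_sum n p)
    ((p - 1)%:R * (\sum_(1 <= a < p) (a ^ n)%N)%:R * (1 + gaussI ^+ n)).
Proof.
apply: congr_mod_sum_linear_forms => //; rewrite n_ge1 /=.
by case: p n_le p_prime {p_odd} => [|[|q]] //=; rewrite subSS subn1.
Qed.
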